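(* Let $K$ be a commutative integral domain with identity, $n\ge 1$, and let $\mathcal F=\sum_{|\alpha|=0}^{\infty}a_\alpha D^\alpha$ ($a_\alpha\in K$) be a linear differential operator of infinite order on $K[x_1,\dots,x_n]'$. Suppose that $a_0$ (the coefficient with $\alpha=(0,\dots,0)$) is an invertible element of $K$. Then $\mathcal F:K[x_1,\dots,x_n]'\to K[x_1,\dots,x_n]'$ is bijective and its inverse $\mathcal F^{-1}$ is a continuous mapping. Moreover, with $I$ the identity mapping, $$\mathcal F^{-1}=a_0^{-1}\sum_{k=0}^{\infty}(I-a_0^{-1}\mathcal F)^k,$$ where the series on the right-hand side converges in the topology of $K[x_1,\dots,x_n]'$ (that is, for every $T\in K[x_1,\dots,x_n]'$ the series $\sum_{k=0}^\infty (I-a_0^{-1}\mathcal F)^kT$ converges in $K[x_1,\dots,x_n]'$ and $\mathcal F^{-1}T=a_0^{-1}\sum_{k=0}^\infty (I-a_0^{-1}\mathcal F)^kT$). In particular, for any copolynomial $T\in K[x_1,\dots,x_n]'$ there exists a unique solution $u\in K[x_1,\dots,x_n]'$ of the equation $\mathcal F u=T$. This solution admits the representations $$u=\mathcal F^{-1}(T)=\mathcal F^{-1}(\delta)*T$$ and depends continuously on $T$ in the topology of $K[x_1,\dots,x_n]'$.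
   Context: A copolynomial over $K$ is a $K$-linear map $T:K[x_1,\dots,x_n]\to K$; $K[x_1,\dots,x_n]'$ is the $K$-module of copolynomials, and $(T,p)$ denotes the value of $T$ at $p$. Topology: $K$ is discrete and $K[x_1,\dots,x_n]'$ carries the topology of pointwise convergence; so $T_k\to T$ iff for every polynomial $p$ there is $k_0$ with $(T_k,p)=(T,p)$ for all $k\ge k_0$. A series converges if its partial sums converge. Derivatives: for $\alpha\in\mathbb N_0^n$, $|\alpha|=\sum_j\alpha_j$, $D^\alpha=\frac{\partial^{|\alpha|}}{\partial x_1^{\alpha_1}\cdots\partial x_n^{\alpha_n}}$, and $(D^\alpha T,p)=(-1)^{|\alpha|}(T,D^\alpha p)$. The operator $\mathcal F=\sum_{|\alpha|=0}^\infty a_\alpha D^\alpha$ acts by $(\mathcal F T,p)=\sum_{|\alpha|\le m}a_\alpha (D^\alpha T,p)$ where $m=\deg p$. The $\delta$-function is the copolynomial $(\delta,p)=p(0)$. For a polynomial $p$ of degree $m$, the polynomials $\frac{D^\alpha p}{\alpha!}\in K[x_1,\dots,x_n]$ are defined (over any $K$) by $p(x+h)=\sum_{|\alpha|\le m}\frac{D^\alpha p(x)}{\alpha!}h^\alpha$. The convolution of $T_1,T_2\in K[x_1,\dots,x_n]'$ is the copolynomial $(T_1*T_2,p)=\sum_{|\alpha|\le m}\left(T_1,\frac{D^\alpha p}{\alpha!}\right)(T_2,x^\alpha)$, $m=\deg p$. *)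

(* Defs.v *)
From HB Require Import structures.
From mathcomp Require Import all_boot all_order all_algebra.
From mathcomp Require Import ssrcomplements mpoly.
From mathcomp Require Import boolp classical_sets functions topology sequences.

Set Implicit Arguments.
Unset Strict Implicit.
Unset Printing Implicit Defensive.

Import GRing.Theory.
Local Open Scope classical_set_scope.
Local Open Scope ring_scope.

Definition copoly (n : nat) (K : idomainType) : Type := {scalar {mpoly K[n]}}.

Section Copoly.
Context (n : nat) (K : idomainType).
Implicit Types (T S : copoly n K) (p q : {mpoly K[n]}) (c : K).

Definition mkcopoly (f : {mpoly K[n]} -> K) (lf : scalar f) : copoly n K :=
  HB.pack_for {scalar {mpoly K[n]}} f
    (GRing.isLinear.Build K {mpoly K[n]} K *%R f lf).

Lemma copolyP T S : (forall p, T p = S p) -> T = S.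
Proof.
case: T => f [[fA] [fZ]]; case: S => g [[gA] [gZ]] /= fg.
have {fg} efg : f = g by apply/funext => p; apply: fg.
rewrite -{}efg in gA gZ *.
by congr GRing.Linear.Pack; congr GRing.Linear.Class;
  [congr Algebra.isNmodMorphism.Axioms_ | congr GRing.isScalable.Axioms_];
  apply: Prop_irrelevance.
Qed.

Lemma copoly_linearP T c p q : T (c *: p + q) = c * T p + T q.
Proof. by rewrite linearP. Qed.

Lemma copoly0_subproof : scalar (fun _ : {mpoly K[n]} => 0 : K).
Proof. by move=> c p q; rewrite mulr0 addr0. Qed.

Lemma copolyN_subproof T : scalar (fun p => - T p).
Proof. by move=> c p q; rewrite copoly_linearP opprD mulrN. Qed.

Lemma copolyD_subproof T S : scalar (fun p => T p + S p).
Proof. by move=> c p q; rewrite !copoly_linearP mulrDr addrACA. Qed.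

Lemma copolyZ_subproof c T : scalar (fun p => c * T p).
Proof. by move=> d p q; rewrite copoly_linearP mulrDr mulrCA. Qed.

Definition copoly0 := mkcopoly copoly0_subproof.
Definition copolyN T := mkcopoly (copolyN_subproof T).
Definition copolyD T S := mkcopoly (copolyD_subproof T S).
Definition copolyZ c T := mkcopoly (copolyZ_subproof c T).

HB.instance Definition _ := gen_eqMixin (copoly n K).
HB.instance Definition _ := gen_choiceMixin (copoly n K).

Lemma copolyDA : associative copolyD.
Proof. by move=> T S U; apply: copolyP => p /=; rewrite addrA. Qed.
Lemma copolyDC : commutative copolyD.
Proof. by move=> T S; apply: copolyP => p /=; rewrite addrC. Qed.
Lemma copoly0D : left_id copoly0 copolyD.
Proof. by move=> T; apply: copolyP => p /=; rewrite add0r. Qed.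
Lemma copolyND : left_inverse copoly0 copolyN copolyD.
Proof. by move=> T; apply: copolyP => p /=; rewrite addNr. Qed.

HB.instance Definition _ :=
  GRing.isZmodule.Build (copoly n K) copolyDA copolyDC copoly0D copolyND.

Lemma copolyZA c d T : copolyZ c (copolyZ d T) = copolyZ (c * d) T.
Proof. by apply: copolyP => p /=; rewrite mulrA. Qed.
Lemma copoly1Z : left_id 1 copolyZ.
Proof. by move=> T; apply: copolyP => p /=; rewrite mul1r. Qed.
Lemma copolyZDr : right_distributive copolyZ +%R.
Proof. by move=> c T S; apply: copolyP => p /=; rewrite mulrDr. Qed.
Lemma copolyZDl T : {morph copolyZ^~ T : c d / c + d}.
Proof. by move=> c d; apply: copolyP => p /=; rewrite mulrDl. Qed.

HB.instance Definition _ :=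
  GRing.Zmodule_isLmodule.Build K (copoly n K)
    copolyZA copoly1Z copolyZDr copolyZDl.

Definition copoly_ptws T : {ptws {mpoly K[n]} -> discrete_topology K} :=
  fun p => T p.

HB.instance Definition _ :=
  Topological.copy (copoly n K) (initial_topology copoly_ptws).

End Copoly.

Section Operators.
Context (n : nat) (K : idomainType).
Implicit Types (T S : copoly n K) (p q : {mpoly K[n]}) (c : K).

(* For [p != 0], [msize p] is [deg p + 1], so summing over ['X_{1..n < msize p}]
   is summing over the multi-indices [m] with [|m| <= deg p]; for [p = 0] both
   sums vanish. *)

Lemma bmnm_widen (F : 'X_{1..n} -> K) (j k : nat) : (j <= k)%N ->
  (forall m, (j <= mdeg m)%N -> F m = 0) ->
  \sum_(m : 'X_{1..n < j}) F m = \sum_(m : 'X_{1..n < k}) F m.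
Proof.
move=> le_jk F0.
rewrite (@big_sub_widen _ _ _ _ _ _ 'X_{1..n < j} 'X_{1..n < k} xpredT F) /=.
  rewrite [RHS](bigID (fun m : 'X_{1..n < k} => (mdeg m < j)%N)) /=.
  by rewrite [X in _ + X]big1 ?addr0 // => m; rewrite -leqNgt => /F0.
by move=> m /leq_trans; apply.
Qed.

Lemma window_scalar (F : {mpoly K[n]} -> 'X_{1..n} -> K) :
  (forall m, scalar (F^~ m)) ->
  (forall p m, (msize p <= mdeg m)%N -> F p m = 0) ->
  scalar (fun p => \sum_(m : 'X_{1..n < msize p}) F p m).
Proof.
move=> Fl F0 c p q.
pose k := maxn (msize (c *: p + q)) (maxn (msize p) (msize q)).
rewrite !(@bmnm_widen (F _) _ k); try by [apply: F0 | rewrite /k !leq_max !leqnn ?orbT].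
by rewrite mulr_sumr -big_split; apply: eq_bigr => m _; apply: Fl.
Qed.

Lemma mderivm_eq0 p m : (msize p <= mdeg m)%N -> p^`M[m] = 0.
Proof.
move=> le_pm; rewrite mderivmE big_seq big1 // => m' m'p.
have [i lt_i] : exists i, (m' i < m i)%N.
  apply/existsP; apply: contraTT (leq_trans (msize_mdeg_lt m'p) le_pm).
  rewrite negb_exists -leqNgt => /forallP h; rewrite !mdegE.
  by apply: leq_sum => i _; rewrite leqNgt.
by rewrite (bigD1 i) //= ffact_small // mul0n mulr0 scale0r.
Qed.

Lemma dcopoly_subproof (m : 'X_{1..n}) T :
  scalar (fun p => (-1) ^+ mdeg m * T p^`M[m]).
Proof.
by move=> c p q; rewrite linearP copoly_linearP mulrDr mulrCA.
Qed.

Definition dcopoly (m : 'X_{1..n}) T : copoly n K :=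
  mkcopoly (dcopoly_subproof m T).

Lemma diffop_subproof (a : 'X_{1..n} -> K) T :
  scalar (fun p => \sum_(m : 'X_{1..n < msize p}) a m * dcopoly m T p).
Proof.
apply: (window_scalar (F := fun p m => a m * dcopoly m T p)).
  by move=> m c p q; rewrite copoly_linearP mulrDr mulrCA.
by move=> p m le_pm; rewrite /= mderivm_eq0 // linear0 !mulr0.
Qed.

Definition diffop (a : 'X_{1..n} -> K) T : copoly n K :=
  mkcopoly (diffop_subproof a T).

Lemma delta_subproof : scalar (fun p => p.@[fun _ => 0]).
Proof. by move=> c p q; rewrite mevalD mevalZ. Qed.

Definition delta : copoly n K := mkcopoly delta_subproof.

(* [p(x + h)], as a polynomial in [h] with coefficients in [K[x]]. *)
Definition mshift p : {mpoly {mpoly K[n]}[n]} :=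
  mmap ((@mpolyC n {mpoly K[n]}) \o (@mpolyC n K))
       (fun i => ('X_i)%:MP + 'X_i) p.

(* [D^m p / m!], the coefficient of [h^m] in [p(x + h)]. *)
Definition divderiv (m : 'X_{1..n}) p : {mpoly K[n]} := (mshift p)@_m.

Lemma mshift_is_linear c p q :
  mshift (c *: p + q) = (c%:MP)%:MP * mshift p + mshift q.
Proof. by rewrite /mshift mmapD mmapZ. Qed.

Lemma divderiv_is_linear m : linear (divderiv m).
Proof.
move=> c p q.
by rewrite /divderiv mshift_is_linear mcoeffD mcoeffCM mul_mpolyC.
Qed.

Lemma msizeM_bound d e (f g : {mpoly {mpoly K[n]}[n]}) :
  (msize f <= d.+1)%N -> (msize g <= e.+1)%N -> (msize (f * g) <= (d + e).+1)%N.
Proof.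
have [->|f0] := eqVneq f 0; first by rewrite mul0r msize0.
have [->|g0] := eqVneq g 0; first by rewrite mulr0 msize0.
move=> lf lg; rewrite msizeM // -ltnS prednK.
  by apply: leq_trans (leq_add lf lg) _; rewrite addSn addnS.
by rewrite addn_gt0 lt0n msize_poly_eq0 f0.
Qed.

Lemma msize_shiftX m :
  (msize (mmap1 (fun i => (('X_i)%:MP + 'X_i)%R : {mpoly {mpoly K[n]}[n]}) m)
     <= (mdeg m).+1)%N.
Proof.
rewrite /mmap1 mdegE.
apply: (big_ind2 (fun f d => (msize f <= d.+1)%N)); first by rewrite msize1.
  by move=> f d g e; apply: msizeM_bound.
move=> i _; elim: (m i) => [|d IHd]; first by rewrite expr0 msize1.
rewrite exprS -add1n; apply: (@msizeM_bound 1 d _ _ _ IHd).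
apply: leq_trans (mmeasureD_le _ _ _) _.
by rewrite geq_max -!/(msize _) msizeX mdeg1 andbT msizeC; case: eqP.
Qed.

Lemma divderiv_eq0 p m : (msize p <= mdeg m)%N -> divderiv m p = 0.
Proof.
move=> le_pm; rewrite /divderiv /mshift /mmap raddf_sum big_seq big1 //= => m' m'p.
rewrite mcoeffCM [X in _ * X]memN_msupp_eq0 ?mulr0 //; apply: msize_mdeg_ge.
exact: leq_trans (msize_shiftX m') (leq_trans (msize_mdeg_lt m'p) le_pm).
Qed.

Lemma conv_subproof T S :
  scalar (fun p => \sum_(m : 'X_{1..n < msize p}) T (divderiv m p) * S 'X_[m]).
Proof.
apply: (window_scalar (F := fun p m => T (divderiv m p) * S 'X_[m])).
  by move=> m c p q; rewrite divderiv_is_linear copoly_linearP mulrDl mulrA.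
by move=> p m le_pm; rewrite divderiv_eq0 // linear0 mul0r.
Qed.

Definition conv T S : copoly n K := mkcopoly (conv_subproof T S).

End Operators.

Arguments delta {n K}.

(* Main.v *)
Require Import Defs.
From mathcomp Require Import all_boot all_order all_algebra.
From mathcomp Require Import mpoly.
From mathcomp Require Import mathcomp_extra boolp classical_sets functions.
From mathcomp Require Import topology sequences.

(** The proof transposes everything to polynomials.  By definition
[F T = T \o A], where [A] is the polynomial operator
[p |-> \sum_m a_m (-1)^|m| D^m p] ([diffop_trE]).  Since [a_0] is invertible,
[N := 1 - a_0^-1 A] is made only of the terms of positive order, so it strictly
lowers the degree ([msize_defect_tr]) and [N^k p = 0] as soon as [k] reaches
[msize p].  With [L := I - a_0^-1 F], one has [L^k T = T \o N^k] ([L] and [N] are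
[defect] and [defect_tr] below): evaluated at a fixed [p], the Neumann series [\sum_k L^k T] is a finite sum.  It therefore
converges pointwise ([cvg_neumann]), and telescoping shows that its sum inverts
[I - L = a_0^-1 F] on both sides ([neumann_sub_defect], [sub_defect_neumann]).

The inverse is again the transpose of a map of polynomials: its value at [p]
reads [T] at a single polynomial, and this is continuity for the topology of
pointwise convergence in a discrete ring ([transpose_continuous]).

For the convolution formula, [F] commutes with [U |-> U * T] because [D^m]
commutes with the divided derivatives ([divderiv_mderivm], [diffop_conv]), and
[delta] is a left unit ([conv_delta]).  Hence
[F (F^-1 delta * T) = delta * T = T]. *)

Set Implicit Arguments.
Unset Strict Implicit.
Unset Printing Implicit Defensive.

Import GRing.Theory.
Local Open Scope classical_set_scope.
Local Open Scope ring_scope.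

(** * The topology of pointwise convergence *)

Section Topology.
Context (n : nat) (K : idomainType).
Implicit Types (T U : copoly n K) (p q : {mpoly K[n]}).

(** Evaluation at [p] is continuous into the discrete ring [K], so it is locally
constant. *)
Lemma near_copoly_eval T p : nbhs T [set U : copoly n K | U p = T p].
Proof.
pose X := fun _ : {mpoly K[n]} => discrete_topology K.
have ev : {for T, continuous (proj p \o @copoly_ptws n K : _ -> X p)}.
  apply: continuous_comp; first exact: initial_continuous.
  exact: (@proj_continuous _ X p).
apply: (ev [set T p]).
by rewrite /nbhs /= /principal_filter; apply/principal_filterP.
Qed.

(** In a discrete ring, convergence of the values at [p] means that they are
eventually equal to the limit. *)
Lemma cvg_copoly (F : set_system (copoly n K)) T {FF : Filter F} :
  (forall p, F [set U : copoly n K | U p = T p]) -> F --> T.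
Proof.
move=> FT.
have cF : {ptws, (@copoly_ptws n K) @ F --> copoly_ptws T}.
  apply/cvg_sup => p A /= [_ [[B Bop <-] BT sBA]].
  apply: filterS sBA _; apply: filterS (FT p) => U UT.
  have {}UT : U p = T p := UT.
  by rewrite /= /copoly_ptws UT; exact: BT.
move=> A /= [_ [[B Bop <-] BT sBA]].
apply: filterS sBA _; apply: cF.
exact: open_nbhs_nbhs.
Qed.

(** The value of [G T] at [p] depends on [T] only through its value at the one
polynomial [B p]. *)
Lemma transpose_continuous (G : copoly n K -> copoly n K)
    (B : {mpoly K[n]} -> {mpoly K[n]}) :
  (forall T p, G T p = T (B p)) -> continuous G.
Proof.
move=> GB T; have FT := fmap_filter G (F := nbhs T).
apply: cvg_copoly => p.
by apply: filterS (near_copoly_eval T (B p)) => U; rewrite /= !GB.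
Qed.

End Topology.

(** * Differential operators as transposes *)

Section Transpose.
Context (n : nat) (K : idomainType) (a : 'X_{1..n} -> K).
Implicit Types (T U : copoly n K) (p q : {mpoly K[n]}) (m : 'X_{1..n}).

Lemma diffopE U p : diffop a U p =
  \sum_(m : 'X_{1..n < msize p}) a m * ((-1) ^+ mdeg m * U p^`M[m]).
Proof. by []. Qed.

(** The hypothesis bears on the derivatives of [p] rather than on its degree:
it is used for divided derivatives of a polynomial, whose derivatives are known
to vanish without a bound on their own degree. *)
Lemma diffop_widen U p j :
  (forall m, (j <= mdeg m)%N -> p^`M[m] = 0) ->
  diffop a U p = \sum_(m : 'X_{1..n < j}) a m * ((-1) ^+ mdeg m * U p^`M[m]).
Proof.
move=> pj; pose F m := a m * ((-1) ^+ mdeg m * U p^`M[m]).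
have F0 m : p^`M[m] = 0 -> F m = 0 by move=> pm; rewrite /F pm linear0 !mulr0.
rewrite diffopE (@bmnm_widen n K F _ (maxn j (msize p))) ?leq_maxr //.
  by rewrite (@bmnm_widen n K F j (maxn j (msize p))) ?leq_maxl // => m /pj/F0.
by move=> m /mderivm_eq0/F0.
Qed.

Lemma msize_mderivm m p j :
  (msize p <= j + mdeg m)%N -> (msize p^`M[m] <= j)%N.
Proof.
move=> pj; rewrite [msize p^`M[m]]mmeasureE; apply/bigmax_leqP_seq => m' + _.
rewrite mcoeff_msupp mcoeff_mderivm => nz.
have mm' : (m + m')%MM \in msupp p.
  by rewrite mcoeff_msupp; apply: contraNneq nz => ->; rewrite mul0rn.
have := leq_trans (msize_mdeg_lt mm') pj.
by rewrite mdegD addnC ltn_add2r.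
Qed.

Definition diffop_tr p : {mpoly K[n]} :=
  \sum_(m : 'X_{1..n < msize p}) (a m * (-1) ^+ mdeg m) *: p^`M[m].

Lemma diffop_trE U p : diffop a U p = U (diffop_tr p).
Proof.
rewrite diffopE /diffop_tr linear_sum; apply: eq_bigr => m _.
by rewrite linearZ /= mulrA.
Qed.

End Transpose.

(** * The Neumann series *)

Section Neumann.
Context (n : nat) (K : idomainType) (a : 'X_{1..n} -> K).
Context (a0_unit : a 0%MM \is a GRing.unit).
Implicit Types (T U : copoly n K) (p q : {mpoly K[n]}) (m : 'X_{1..n}).

(** The operator [L = I - a_0^-1 F], whose powers form the series. *)
Definition defect U : copoly n K := U - (a 0%MM)^-1 *: diffop a U.

Definition defect_tr p : {mpoly K[n]} := p - (a 0%MM)^-1 *: diffop_tr a p.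

Lemma diffop_defect U : diffop a U = a 0%MM *: (U - defect U).
Proof. by rewrite /defect subKr scalerA divrr // scale1r. Qed.

Lemma defect_trE U p : defect U p = U (defect_tr p).
Proof. by rewrite linearB linearZ /= -diffop_trE. Qed.

Lemma iter_defect_trE k U p : iter k defect U p = U (iter k defect_tr p).
Proof. by elim: k U => // k IHk U; rewrite iterSr IHk defect_trE. Qed.

(** The term of order [0] of [a_0^-1 A p] is [p] itself and cancels; what remains
is made of derivatives of order at least [1]. *)
Lemma msize_defect_tr p : (msize (defect_tr p) <= (msize p).-1)%N.
Proof.
have [->|p0] := eqVneq p 0.
  have -> : defect_tr 0 = 0; last by rewrite msize0.
  rewrite /defect_tr /diffop_tr big1 ?scaler0 ?subr0 // => m _.
  by rewrite linear0 scaler0.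
have lt0 : (mdeg (0%MM : 'X_{1..n}) < msize p)%N.
  by rewrite mdeg0 lt0n msize_poly_eq0.
rewrite /defect_tr /diffop_tr (bigD1 (BMultinom lt0)) //= scalerDr.
rewrite mdeg0 mulr1 mderivm0m scalerA mulVr // scale1r opprD addNKr.
rewrite msizeN (leq_trans (msizeZ_le _ _)) //.
apply: leq_trans (mmeasure_sum _ _ _ _) _; apply/bigmax_leqP => m m0.
rewrite (leq_trans (msizeZ_le _ _)) //; apply: msize_mderivm.
have m_gt0 : (0 < mdeg m)%N.
  rewrite lt0n mdeg_eq0; apply: contraNneq m0 => m0; exact/eqP/val_inj.
apply: leq_trans (leqSpred _) _; rewrite -addn1; exact: leq_add (leqnn _) m_gt0.
Qed.

Lemma iter_defect_tr_eq0 k p : (msize p <= k)%N -> iter k defect_tr p = 0.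
Proof.
elim: k p => [|k IHk] p pk; first by apply/eqP; rewrite -msize_poly_eq0 -leqn0.
rewrite iterSr IHk // (leq_trans (msize_defect_tr p)) //.
by rewrite -subn1 leq_subLR add1n.
Qed.

Lemma neumann_widen T p j : (msize p <= j)%N ->
  \sum_(k < msize p) iter k defect T p = \sum_(k < j) iter k defect T p.
Proof.
move=> pj; rewrite (big_ord_widen j (fun k => iter k defect T p)) //.
rewrite [RHS](bigID (fun k : 'I_j => (k < msize p)%N)) /=.
rewrite [X in _ + X]big1 ?addr0 // => k; rewrite -leqNgt => pk.
by rewrite iter_defect_trE iter_defect_tr_eq0 ?linear0.
Qed.

Lemma neumann_subproof T :
  scalar (fun p => \sum_(k < msize p) iter k defect T p).
Proof.
move=> c p q; pose j := maxn (msize (c *: p + q)) (maxn (msize p) (msize q)).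
rewrite !(@neumann_widen _ _ j) ?leq_max ?leqnn ?orbT //.
by rewrite mulr_sumr -big_split; apply: eq_bigr => k _; apply: copoly_linearP.
Qed.

(** The sum is cut at [msize p] because all later terms vanish at [p]; the
linearity in [p] comes from cutting at a common larger bound. *)
Definition neumann T : copoly n K := mkcopoly (neumann_subproof T).

Lemma neumannE T p j : (msize p <= j)%N ->
  neumann T p = \sum_(k < j) T (iter k defect_tr p).
Proof.
move=> pj; rewrite /= (neumann_widen _ pj).
by apply: eq_bigr => k _; apply: iter_defect_trE.
Qed.

(** The sum telescopes to [T p - T (N^(msize p) p)], and the last power is zero.
Both inversion identities reduce to it: they only differ by whether [N] is
applied to [p] after or before the other [k] factors. *)
Lemma defect_telescope T p :
  \sum_(k < msize p) (T (iter k defect_tr p) - T (iter k.+1 defect_tr p)) = T p.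
Proof.
rewrite -(big_mkord xpredT
  (fun k => T (iter k defect_tr p) - T (iter k.+1 defect_tr p))).
under eq_bigr do rewrite -opprB.
by rewrite sumrN telescope_sumr // iter_defect_tr_eq0 // linear0 sub0r opprK.
Qed.

Lemma neumann_sub_defect T : neumann (T - defect T) = T.
Proof.
apply: copolyP => p; rewrite (neumannE _ (leqnn _)) -[RHS]defect_telescope.
by apply: eq_bigr => k _; rewrite [LHS]/= -defect_trE.
Qed.

Lemma sub_defect_neumann T : neumann T - defect (neumann T) = T.
Proof.
apply: copolyP => p.
have -> : (neumann T - defect (neumann T)) p
    = neumann T p - neumann T (defect_tr p) by rewrite -defect_trE.
rewrite !(@neumannE _ _ (msize p)) //; last first.
  exact: leq_trans (msize_defect_tr p) (leq_pred _).
rewrite -sumrB -[RHS]defect_telescope.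
by apply: eq_bigr => k _; rewrite iterSr.
Qed.

Lemma neumannZ c T : neumann (c *: T) = c *: neumann T.
Proof.
apply: copolyP => p; have -> : (c *: neumann T) p = c * neumann T p by [].
by rewrite !(neumannE _ (leqnn _)) mulr_sumr; apply: eq_bigr.
Qed.

Definition diffop_inv T : copoly n K := (a 0%MM)^-1 *: neumann T.

Lemma diffopK : cancel (diffop a) diffop_inv.
Proof.
move=> U; rewrite /diffop_inv diffop_defect neumannZ neumann_sub_defect.
by rewrite scalerA mulVr // scale1r.
Qed.

Lemma diffop_invK : cancel diffop_inv (diffop a).
Proof.
move=> T; rewrite /diffop_inv -neumannZ diffop_defect sub_defect_neumann.
by rewrite scalerA divrr // scale1r.
Qed.

Lemma diffop_inv_continuous : continuous diffop_inv.
Proof.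
apply: (@transpose_continuous _ _ _ (fun p =>
  (a 0%MM)^-1 *: \sum_(k < msize p) iter k defect_tr p)) => T p.
by rewrite linearZ linear_sum -neumannE.
Qed.

Lemma cvg_neumann T : series (fun k => iter k defect T) @ \oo --> neumann T.
Proof.
apply: cvg_copoly => p; exists (msize p) => // j /= pj.
rewrite /neumann /= (neumann_widen _ pj) /series /= big_mkord.
elim/big_ind2: _ => //.
by move=> U x V y <- <-.
Qed.

End Neumann.

(** * Convolution and the delta function *)

Section Convolution.
Context (n : nat) (K : idomainType).
Implicit Types (T U : copoly n K) (p q : {mpoly K[n]}) (m : 'X_{1..n}).

(** Induction through the ring structure, for properties that behave well with
respect to products: this avoids the multinomial coefficients of
[(x + h)^m]. *)
Lemma mpoly_ring_ind (P : {mpoly K[n]} -> Prop) :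
  (forall c p q, P p -> P q -> P (c *: p + q)) ->
  P 1 -> (forall i, P 'X_i) -> (forall p q, P p -> P q -> P (p * q)) ->
  forall p, P p.
Proof.
move=> PL P1 PX PM.
have P0 : P 0 by have := PL (-1) _ _ P1 P1; rewrite scaleN1r addNr.
have PXm m : P 'X_[m].
  rewrite mpolyXE_id; elim/big_ind: _ => // i _.
  by elim: (m i) => [|d IHd]; rewrite ?expr0 // exprS; apply: PM.
by elim/mpolyind => // c m p _ _; apply: PL.
Qed.

Lemma mshiftM : {morph @mshift n K : p q / p * q}.
Proof. by move=> p q; rewrite /mshift rmorphM. Qed.

Lemma divderivD m : {morph @divderiv n K m : p q / p + q}.
Proof. by move=> p q; rewrite /divderiv /mshift mmapD mcoeffD. Qed.

(** The Leibniz rule for divided derivatives: [p(x + h)] is multiplicative in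
[p], and its coefficients in [h] multiply by the Cauchy product. *)
Lemma divderivM m p q : divderiv m (p * q) =
  \sum_(k : 'X_{1..n < (mdeg m).+1, (mdeg m).+1} | m == (k.1 + k.2)%MM)
    divderiv k.1 p * divderiv k.2 q.
Proof. by rewrite /divderiv mshiftM mcoeffM. Qed.

Lemma mshiftC (c : K) : mshift c%:MP_[n] = (c%:MP)%:MP.
Proof. by rewrite /mshift mmapC. Qed.

Lemma mshiftX i : mshift ('X_i : {mpoly K[n]}) = ('X_i)%:MP + 'X_i.
Proof. by rewrite /mshift mmapX mmap1U. Qed.

Lemma mderivXU (i j : 'I_n) : ('X_j : {mpoly K[n]})^`M(i) = ((j == i)%:R)%:MP.
Proof.
rewrite mderivX mnm1E; case: eqP => [->|_]; last by rewrite scale0r mpolyC0.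
have -> : (U_(i) - U_(i))%MM = 0%MM :> 'X_{1..n}.
  by apply/mnmP => k; rewrite mnmBE subnn mnm0E.
by rewrite scale1r mpolyX0.
Qed.

(** Over a ring of positive characteristic [D^m p / m!] is not determined by
[D^m p], so the commutation of partial derivatives does not give this.  As
functions of [p], the two sides are the coefficients of [mshift (D_i p)] and
those of [mshift p] differentiated in [x_i].  Both are derivations along the
ring morphism [mshift], and they agree on constants and on the variables. *)
Lemma divderiv_mderiv i m p : divderiv m p^`M(i) = (divderiv m p)^`M(i).
Proof.
elim/mpoly_ring_ind: p m => [c p q IHp IHq||j|p q IHp IHq] m.
- by rewrite divderiv_is_linear !linearD !linearZ /= divderiv_is_linear IHp IHq.
- rewrite -mpolyC1 mderivC /divderiv -mpolyC0 !mshiftC !mcoeffC.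
  by rewrite mpolyC0 mpolyC1 mul0r mulr_natr mderivMn -mpolyC1 mderivC mul0rn.
- rewrite mderivXU /divderiv mshiftC mshiftX mcoeffD !mcoeffC mcoeffX.
  rewrite !mulr_natr mderivD !mderivMn mderivXU -mpolyC1 mderivC.
  by rewrite mul0rn addr0.
- rewrite mderivM divderivD (divderivM m p^`M(i) q) (divderivM m p q^`M(i)).
  rewrite (divderivM m p q) [RHS]raddf_sum -big_split.
  by apply: eq_bigr => k _; rewrite /= mderivM IHp IHq.
Qed.

Lemma divderiv_mderivm m' m p : divderiv m p^`M[m'] = (divderiv m p)^`M[m'].
Proof.
rewrite !mderivm_foldr; elim: (flatten _) => //= i s <-.
exact: divderiv_mderiv.
Qed.

(** Setting [x = 0] in [p(x + h)] gives back [p], in the variables [h]: this is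
a ring morphism that fixes the constants and the variables. *)
Lemma meval0_mshift p : map_mpoly (meval (fun _ => 0)) (mshift p) = p.
Proof.
pose e : {rmorphism {mpoly K[n]} -> K} := meval (fun _ => 0).
pose E : {rmorphism {mpoly {mpoly K[n]}[n]} -> {mpoly K[n]}} := map_mpoly e.
have EC f : E f%:MP = (e f)%:MP := map_mpolyC n e f.
have eC c : e c%:MP = c := mevalC _ c.
rewrite -[LHS]/(E (mshift p)).
elim/mpoly_ring_ind: p => [c p q IHp IHq||i|p q IHp IHq].
- rewrite mshift_is_linear; move: (mshift p) (mshift q) IHp IHq => f g Ef Eg.
  by rewrite (rmorphD E) (rmorphM E) EC eC Ef Eg mul_mpolyC.
- by rewrite -mpolyC1 mshiftC EC eC.
- rewrite mshiftX (rmorphD E) EC [e _]mevalXU mpolyC0 add0r.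
  exact: map_mpolyX.
- rewrite mshiftM; move: (mshift p) (mshift q) IHp IHq => f g Ef Eg.
  by rewrite (rmorphM E) Ef Eg.
Qed.

(** Taylor's formula at [0], without division. *)
Lemma delta_divderiv m p : delta (divderiv m p) = p@_m.
Proof. by rewrite -[in RHS](meval0_mshift p) mcoeff_map_mpoly. Qed.

Lemma conv_delta T : conv delta T = T.
Proof.
apply: copolyP => p; rewrite [in RHS](mpolywE (leqnn (msize p))) linear_sum.
rewrite [LHS]/=; apply: eq_bigr => m _.
by rewrite linearZ -delta_divderiv.
Qed.

Lemma convE U T p :
  conv U T p = \sum_(m : 'X_{1..n < msize p}) U (divderiv m p) * T 'X_[m].
Proof. by []. Qed.

Lemma conv_widen U T p j : (msize p <= j)%N ->
  conv U T p = \sum_(m : 'X_{1..n < j}) U (divderiv m p) * T 'X_[m].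
Proof.
move=> pj; rewrite convE.
apply: (@bmnm_widen n K (fun m => U (divderiv m p) * T 'X_[m])) => // m pm.
by rewrite divderiv_eq0 // linear0 mul0r.
Qed.

(** Both sides are the double sum of [a_m (-1)^|m| U(D^m (D^k p / k!)) T(x^k)],
once the partial and the divided derivatives are exchanged. *)
Lemma diffop_conv a U T : diffop a (conv U T) = conv (diffop a U) T.
Proof.
apply: copolyP => p; pose j := msize p.
have D0 m : (j <= mdeg m)%N -> p^`M[m] = 0 by apply: mderivm_eq0.
rewrite diffopE convE.
under eq_bigr => m _.
  rewrite (@conv_widen _ _ _ j); last first.
    by apply: msize_mderivm; apply: leq_addr.
  rewrite !mulr_sumr.
over.
rewrite exchange_big; apply: eq_bigr => k _.
rewrite (@diffop_widen _ _ _ _ _ j) ?mulr_suml; last first.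
  by move=> m jm; rewrite -divderiv_mderivm D0 // /divderiv /mshift mmap0 mcoeff0.
by apply: eq_bigr => m _; rewrite divderiv_mderivm !mulrA.
Qed.

End Convolution.

Theorem theorem5p1 (K : idomainType) (n : nat) (a : 'X_{1..n} -> K) :
  (0 < n)%N -> a 0%MM \is a GRing.unit ->
  [/\ bijective (diffop a : copoly n K -> copoly n K),
      (forall G : copoly n K -> copoly n K,
        cancel (diffop a) G -> cancel G (diffop a) ->
        [/\ continuous G,
            (forall T : copoly n K, exists S : copoly n K,
              series (fun k =>
                iter k (fun U => U - (a 0%MM)^-1 *: diffop a U) T) @ \oo --> S
              /\ G T = (a 0%MM)^-1 *: S)
          & (forall T u : copoly n K, diffop a u = T ->
              u = G T /\ u = conv (G delta) T)]),
      (forall T : copoly n K, exists! u : copoly n K, diffop a u = T)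
    & (forall sol : copoly n K -> copoly n K,
        (forall T, diffop a (sol T) = T) -> continuous sol)].
Proof.
move=> _ a0.
have FK := diffopK a0; have KF := diffop_invK a0.
have invE G : cancel G (diffop a) -> G = diffop_inv a0.
  by move=> GK; apply: funext => T; rewrite -[LHS]FK GK.
split.
- by exists (diffop_inv a0).
- move=> G _ /invE->; split.
  + exact: diffop_inv_continuous.
  + by move=> T; exists (neumann a0 T); split; first exact: cvg_neumann.
  + move=> T u <-; split; first by rewrite FK.
    by apply: (can_inj FK); rewrite diffop_conv KF conv_delta.
- move=> T; exists (diffop_inv a0 T); split; first exact: KF.
  by move=> u <-; rewrite FK.
- by move=> sol /invE->; apply: diffop_inv_continuous.
Qed.
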